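(* Let $n$ be a fixed natural number, and let $K$, $x$, $y$, $q$ be sufficiently large integers satisfying $K \le y < x$. Let $$f(u) = \alpha u^n + \alpha_{n-1}u^{n-1} + \ldots + \alpha_1 u$$ be a polynomial of degree $n$ with real coefficients, where $$\alpha = \frac{a}{q} + \frac{\theta}{q^2}, \qquad (a,q)=1,\quad q\ge 1,\qquad |\theta|\le 1 .$$ Then $$V_n(K,x,y) = \sum_{k=1}^K \left| \sum_{x-y<p\le x} e(k f(p)) \right| \ll K y \left( \frac{1}{q} + \frac{1}{y} + \frac{q}{K y^n} + \frac{1}{K^{2^{n-1}}} \right)^{2^{-n-1}} \mathscr{L}^{\frac{n^2}{2^{n+1}}},$$ where $\mathscr{L} = \ln x$.
   Context: Here $e(t) = e^{2\pi i t}$, the inner sum runs over prime numbers $p$ in the interval $(x-y, x]$, and the implied constant in $\ll$ may depend on $n$. *)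

(* Defs.v *)
From HB Require Import structures.
From mathcomp Require Import all_boot all_order all_algebra.
From mathcomp Require Import complex.
From mathcomp Require Import all_classical all_reals all_analysis.

Set Implicit Arguments.
Unset Strict Implicit.
Unset Printing Implicit Defensive.

Import Order.TTheory GRing.Theory Num.Theory.

Local Open Scope ring_scope.
Local Open Scope complex_scope.

(* e(t) = exp(2 pi i t), with exp(i s) = cos s + i sin s for real s *)
Definition e (R : realType) (t : R) : R[i] :=
  cos (2 * pi * t) +i* sin (2 * pi * t).

(* [normc] is the modulus of a complex number as an element of R, whereas
   [`|z|] would live in R[i]. The truncated subtraction [x - y] is the usual
   one as soon as y <= x. *)
Definition V (R : realType) (f : {poly R}) (K x y : nat) : R :=
  \sum_(1 <= k < K.+1)
     ComplexField.Normc.normc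
       (\sum_((x - y).+1 <= p < x.+1 | prime p) e (k%:R * f.[p%:R])).

(* Main.v *)
Require Import Defs.
From HB Require Import structures.
From mathcomp Require Import all_boot all_order all_algebra.
From mathcomp Require Import complex.
From mathcomp Require Import all_classical all_reals all_analysis.
From mathcomp Require Import ring lra zify.

(* The primality of p plays no role. Write V / (K y) as the mean over k <= K of
   |S_k| / y; linearising the moduli with unimodular weights in k and applying
   Cauchy's inequality in u over all integers of (x - y, x] bounds its square by
   1/K + 2 mean_h |T_h| / y, where T_h is the complete sum of e(h f(u)). With
   n = s + 1, s Weyl differencing steps bound the mean of (|T_h| / y)^(2^s) by
   1/y plus a mean of min(1, 1/(y ||n! alpha m||)) over m <= K y^s, weighted by
   the number of factorisations of m into n factors. A second Cauchy inequality
   separates the weights, whose mean square is O(log^(n^2)), from the mean of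
   min(1, 1/(y ||n! alpha m||))^2, which is estimated over blocks of q
   consecutive integers using alpha = a/q + O(1/q^2). *)

Set Implicit Arguments.
Unset Strict Implicit.
Unset Printing Implicit Defensive.

Import Order.TTheory GRing.Theory Num.Theory.
Import numFieldNormedType.Exports.

Local Open Scope ring_scope.
Local Notation normc := ComplexField.Normc.normc.

(** * Finite sums and means *)

Section FiniteSums.

Lemma ler_sum_uniq_sub (R : numDomainType) (I : eqType) (r r' : seq I)
    (F : I -> R) :
  uniq r -> {subset r <= r'} -> (forall i, 0 <= F i) ->
  \sum_(i <- r) F i <= \sum_(i <- r') F i.
Proof.
move=> + + F0; elim: r r' => [|i r IHr] r' /=.
  by rewrite big_nil => _ _; exact: sumr_ge0.
move=> /andP[ir uniq_r] sub_r'.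
have i_r' : i \in r' by apply: sub_r'; exact: mem_head.
rewrite big_cons (big_rem i i_r') /= lerD2l; apply: IHr => // j jr.
apply: rem_mem; first by apply: contraNneq ir => <-.
by apply: sub_r'; rewrite inE jr orbT.
Qed.

Lemma ler_sum_index_iota (R : numDomainType) (F : nat -> R) (m n n' : nat) :
  (n <= n')%N -> (forall i, 0 <= F i) ->
  \sum_(m <= i < n) F i <= \sum_(m <= i < n') F i.
Proof.
move=> nn' F0; apply: ler_sum_uniq_sub => //; first exact: iota_uniq.
by move=> i; rewrite !mem_index_iota => /andP[-> /leq_trans ->].
Qed.

Context {R : realDomainType}.

Lemma sum_CauchySchwarz (I : Type) (r : seq I) (a b : I -> R) :
  (\sum_(i <- r) a i * b i) ^+ 2 <=
  (\sum_(i <- r) a i ^+ 2) * (\sum_(i <- r) b i ^+ 2).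
Proof.
have : 0 <= \sum_(i <- r) \sum_(j <- r) (a i * b j - a j * b i) ^+ 2.
  by apply: sumr_ge0 => i _; apply: sumr_ge0 => j _; exact: sqr_ge0.
set S := \sum_(i <- r) a i * b i.
set A := \sum_(i <- r) a i ^+ 2; set B := \sum_(i <- r) b i ^+ 2.
have -> : \sum_(i <- r) \sum_(j <- r) (a i * b j - a j * b i) ^+ 2 =
          A * B + B * A - 2 * (S * S).
  rewrite [A * B]big_distrlr [B * A]big_distrlr [S * S]big_distrlr /=.
  rewrite mulr_sumr -big_split -sumrB; apply: eq_bigr => i _ /=.
  rewrite mulr_sumr -big_split -sumrB; apply: eq_bigr => j _ /=.
  by ring.
by rewrite expr2; lra.
Qed.

Lemma sum_Chebyshev (I : Type) (r : seq I) (a b : I -> R) :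
  (forall i j, 0 <= (a i - a j) * (b i - b j)) ->
  (\sum_(i <- r) a i) * (\sum_(i <- r) b i) <=
  (size r)%:R * \sum_(i <- r) a i * b i.
Proof.
move=> ab0.
have : 0 <= \sum_(i <- r) \sum_(j <- r) (a i - a j) * (b i - b j).
  by apply: sumr_ge0 => i _; apply: sumr_ge0 => j _; exact: ab0.
set A := \sum_(i <- r) a i; set B := \sum_(i <- r) b i.
set S := \sum_(i <- r) a i * b i.
have -> : (size r)%:R = \sum_(i <- r) 1 :> R.
  by rewrite big_const_seq count_predT iter_addr_0.
set N := \sum_(i <- r) 1.
have -> : \sum_(i <- r) \sum_(j <- r) (a i - a j) * (b i - b j) =
          N * S + S * N - (A * B + B * A).
  rewrite [N * S]big_distrlr [S * N]big_distrlr [A * B]big_distrlr.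
  rewrite [B * A]big_distrlr -!big_split -sumrB; apply: eq_bigr => i _ /=.
  by rewrite -!big_split -sumrB; apply: eq_bigr => j _ /=; ring.
by lra.
Qed.

Lemma exprn_sum_le (I : Type) (r : seq I) (a : I -> R) (m : nat) :
  (forall i, 0 <= a i) ->
  (\sum_(i <- r) a i) ^+ m.+1 <= (size r)%:R ^+ m * \sum_(i <- r) a i ^+ m.+1.
Proof.
move=> a0; elim: m => [|m IHm]; first by rewrite mul1r.
have sum_a0 : 0 <= \sum_(i <- r) a i by exact: sumr_ge0.
rewrite exprS; apply: le_trans (ler_wpM2l sum_a0 IHm) _.
rewrite mulrCA [_ ^+ m.+1]exprSr -mulrA ler_wpM2l ?exprn_ge0 //.
have -> : \sum_(i <- r) a i ^+ m.+2 = \sum_(i <- r) a i * a i ^+ m.+1.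
  by under eq_bigr do rewrite exprS.
apply: sum_Chebyshev => i j; case: (lerP (a i) (a j)) => [aij|/ltW aji].
  by rewrite mulr_le0 ?subr_le0 // lerXn2r ?nnegrE.
by rewrite mulr_ge0 ?subr_ge0 // lerXn2r ?nnegrE.
Qed.

Lemma exprD_le (a b : R) (m : nat) : 0 <= a -> 0 <= b ->
  (a + b) ^+ m <= 2 ^+ m * (a ^+ m + b ^+ m).
Proof.
move=> a0 b0; case: m => [|m]; first by rewrite !expr0; lra.
have ab0 (i : bool) : 0 <= (if i then a else b) by case: i.
have := exprn_sum_le [:: true; false] m ab0.
rewrite !big_cons !big_nil /= !addr0 => /le_trans; apply.
rewrite ler_wpM2r ?addr_ge0 ?exprn_ge0 // exprS ler_peMl ?exprn_ge0 //.
by rewrite ler1n.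
Qed.

Lemma exprn_double_le (v a b : R) (m : nat) : 0 <= a -> 0 <= b ->
  v ^+ 2 <= a + 2 * b -> v ^+ (2 * m) <= 4 ^+ m * (a ^+ m + b ^+ m).
Proof.
move=> a0 b0 vab; rewrite exprM.
apply: (@le_trans _ _ ((a + 2 * b) ^+ m)).
  by apply: lerXn2r; rewrite ?nnegrE ?sqr_ge0 ?addr_ge0 ?mulr_ge0.
apply: le_trans (exprD_le _ _ _) _; rewrite ?mulr_ge0 //.
have -> : 4 = 2 * 2 :> R by ring.
rewrite !exprMn -mulrA ler_wpM2l ?exprn_ge0 // mulrDr lerD2r.
by rewrite ler_peMl ?exprn_ge0 // exprn_ege1 // ler1n.
Qed.

End FiniteSums.

Section Mean.
Context {R : realFieldType}.
Implicit Types (F G : nat -> R) (n : nat).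

Definition mean (n : nat) (F : nat -> R) : R :=
  (\sum_(1 <= i < n.+1) F i) / n%:R.

Lemma mean_ge0 n F : (forall i, 0 <= F i) -> 0 <= mean n F.
Proof. by move=> F0; rewrite divr_ge0 // sumr_ge0. Qed.

Lemma eq_mean n F G : (forall i, (0 < i <= n)%N -> F i = G i) ->
  mean n F = mean n G.
Proof. by move=> FG; congr (_ / _); exact: eq_big_nat. Qed.

Lemma ler_mean n F G : (forall i, (0 < i <= n)%N -> F i <= G i) ->
  mean n F <= mean n G.
Proof. by move=> FG; rewrite ler_wpM2r ?invr_ge0 // ler_sum_nat. Qed.

Lemma meanZ n (c : R) F : mean n (fun i => c * F i) = c * mean n F.
Proof. by rewrite /mean -mulr_sumr mulrA. Qed.

Lemma meanDl n (c : R) F : (0 < n)%N ->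
  mean n (fun i => c + F i) = c + mean n F.
Proof.
move=> n0; rewrite /mean big_split sumr_const_nat subn1 mulrDl.
by rewrite -[c *+ _]mulr_natr mulfK ?pnatr_eq0 // -lt0n.
Qed.

Lemma exchange_mean m n (F : nat -> nat -> R) :
  mean m (fun i => mean n (F i)) = mean n (fun j => mean m (F^~ j)).
Proof. by rewrite /mean -!mulr_suml exchange_big /= mulrAC. Qed.

Lemma exprn_mean_le n F m : (0 < n)%N -> (forall i, 0 <= F i) ->
  mean n F ^+ m <= mean n (fun i => F i ^+ m).
Proof.
move=> n0 F0; have nR0 : 0 < n%:R :> R by rewrite ltr0n.
case: m => [|m].
  by rewrite expr0 /mean ler_pdivlMr // mul1r sumr_const_nat subn1.
rewrite /mean expr_div_n ler_pdivrMr ?exprn_gt0 //.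
rewrite [n%:R ^+ _]exprS mulrA divfK ?gt_eqF //.
have := exprn_sum_le (index_iota 1 n.+1) m F0.
by rewrite size_iota subn1 mulrC.
Qed.

Lemma mean_CauchySchwarz n F G :
  mean n (fun i => F i * G i) ^+ 2 <=
  mean n (fun i => F i ^+ 2) * mean n (fun i => G i ^+ 2).
Proof.
rewrite /mean expr_div_n mulrACA -invfM -expr2.
by rewrite ler_wpM2r ?invr_ge0 ?sqr_ge0 // sum_CauchySchwarz.
Qed.

End Mean.

(** * Divisor functions *)

Section DivisorSums.
Context {R : realFieldType}.
Implicit Type F : nat -> nat -> R.

Lemma sum_divisors_le F (X : nat) : (forall u v, 0 <= F u v) ->
  \sum_(1 <= m < X.+1) \sum_(u <- divisors m) F u (m %/ u)%N <=
  \sum_(1 <= u < X.+1) \sum_(1 <= v < X.+1) F u v.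
Proof.
move=> F0.
rewrite -(big_allpairs_dep (h := fun m u => (u, m %/ u)%N)
           (F := fun p => F p.1 p.2)).
rewrite -(big_allpairs (F := fun p => F p.1 p.2)).
apply: ler_sum_uniq_sub => //.
- apply: allpairs_uniq_dep => [|m _|p p']; rewrite ?iota_uniq ?divisors_uniq //.
  move=> /allpairsPdep[m [u [m1 um ->]]] /allpairsPdep[m' [u' [m1' um' ->]]] /=.
  rewrite !mem_index_iota in m1 m1'.
  move: um um'; rewrite -!dvdn_divisors; [|by case/andP: m1'|by case/andP: m1].
  by move=> um um' [uu' mm']; rewrite -(divnK um) mm' uu' divnK.
- move=> p /allpairsPdep[m [u [+ + ->]]].
  rewrite mem_index_iota => /andP[m0 mX].
  rewrite -dvdn_divisors // => um; apply/allpairsP; exists (u, m %/ u)%N => /=.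
  have [u0 u_le_m] := (dvdn_gt0 m0 um, dvdn_leq m0 um).
  rewrite !mem_index_iota u0 divn_gt0 // u_le_m (leq_ltn_trans u_le_m) //.
  by rewrite (leq_ltn_trans (leq_div _ _)).
Qed.

Lemma le_sum_divisors F (U V : nat) : (forall u v, 0 <= F u v) ->
  \sum_(1 <= u < U.+1) \sum_(1 <= v < V.+1) F u v <=
  \sum_(1 <= m < (U * V).+1) \sum_(u <- divisors m) F u (m %/ u)%N.
Proof.
move=> F0.
rewrite -(big_allpairs (F := fun p => F p.1 p.2)).
rewrite -(big_allpairs_dep (h := fun m u => (u, m %/ u)%N)
           (F := fun p => F p.1 p.2)).
apply: ler_sum_uniq_sub => //.
  by apply: allpairs_uniq => [||[u v] [u' v'] _ _]; rewrite ?iota_uniq.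
move=> p /allpairsP[[u v] /= []]; rewrite !mem_index_iota.
move=> /andP[u0 uU] /andP[v0 vV] ->; apply/allpairsPdep.
exists (u * v)%N, u; rewrite mem_index_iota muln_gt0 u0 v0 ltnS leq_mul //.
by rewrite -dvdn_divisors ?muln_gt0 ?u0 // dvdn_mulr // mulKn.
Qed.

Lemma mean_mean_le_divisors F (U V : nat) : (forall u v, 0 <= F u v) ->
  mean U (fun u => mean V (F u)) <=
  mean (U * V) (fun m => \sum_(u <- divisors m) F u (m %/ u)%N).
Proof.
move=> F0; rewrite /mean -mulr_suml -mulrA -invfM -natrM [(V * U)%N]mulnC.
by rewrite ler_wpM2r ?invr_ge0 // le_sum_divisors.
Qed.

(* [tau k m] is the number of factorisations of [m] into [k.+1] factors. *)
Fixpoint tau (k m : nat) : nat :=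
  if k is k'.+1 then (\sum_(u <- divisors m) tau k' (m %/ u))%N else 1%N.

(* A divisor w of u v factors as s t with s = gcd(w, u) and t | v. *)
Lemma divisorsM_sub (u v w : nat) : (0 < u)%N -> (0 < v)%N ->
  w \in divisors (u * v) ->
  w \in [seq (s * t)%N | s <- divisors u, t <- divisors v].
Proof.
move=> u0 v0; rewrite -dvdn_divisors ?muln_gt0 ?u0 // => w_uv.
have w0 : (0 < w)%N by apply: dvdn_gt0 w_uv; rewrite muln_gt0 u0.
have s0 : (0 < gcdn w u)%N by rewrite gcdn_gt0 w0.
apply/allpairsP; exists (gcdn w u, w %/ gcdn w u)%N => /=.
rewrite -!dvdn_divisors // dvdn_gcdr mulnC divnK ?dvdn_gcdl //; split=> //.
have coprime_wu : coprime (w %/ gcdn w u) (u %/ gcdn w u).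
  rewrite /coprime -(eqn_pmul2r s0) muln_gcdl.
  by rewrite !divnK ?dvdn_gcdl ?dvdn_gcdr ?mul1n.
rewrite -(Gauss_dvdr _ coprime_wu) -(dvdn_pmul2r s0) mulnAC.
by rewrite !divnK ?dvdn_gcdl ?dvdn_gcdr.
Qed.

Lemma tauM_le (k u v : nat) : (0 < u)%N -> (0 < v)%N ->
  (tau k (u * v) <= tau k u * tau k v)%N.
Proof.
elim: k u v => [//|k IHk] u v u0 v0 /=.
apply: (@leq_trans (\sum_(s <- divisors u) \sum_(t <- divisors v)
                      tau k ((u * v) %/ (s * t)))%N).
  rewrite -(big_allpairs_dep (h := fun s t => (s * t)%N)
             (F := fun w => tau k ((u * v) %/ w))).
  apply: (sub_le_big_seq leqnn (fun i j => leq_addr j i)) => w.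
  rewrite count_uniq_mem ?divisors_uniq //.
  case: (boolP (w \in divisors _)) => // w_uv.
  by rewrite -has_count has_pred1 (divisorsM_sub u0 v0 w_uv).
rewrite big_distrlr /= big_seq [leqRHS]big_seq; apply: leq_sum => s.
rewrite -(dvdn_divisors _ u0) => su.
rewrite big_seq [leqRHS]big_seq; apply: leq_sum => t.
rewrite -(dvdn_divisors _ v0) => tv.
have [s0 t0] := (dvdn_gt0 u0 su, dvdn_gt0 v0 tv).
have -> : ((u * v) %/ (s * t) = (u %/ s) * (v %/ t))%N.
  by rewrite -{1}(divnK su) -{1}(divnK tv) mulnACA mulnK ?muln_gt0 ?s0.
apply: IHk; by rewrite divn_gt0 // dvdn_leq.
Qed.

Lemma sum_tau_div_le (k X : nat) :
  \sum_(1 <= m < X.+1) (tau k m)%:R / m%:R <=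
  (\sum_(1 <= m < X.+1) m%:R^-1) ^+ k.+1 :> R.
Proof.
elim: k => [|k IHk]; first by under eq_bigr do rewrite mul1r.
rewrite exprS; apply: le_trans (ler_wpM2l _ IHk); last first.
  by apply: sumr_ge0 => m _; rewrite invr_ge0.
rewrite big_distrlr /=.
apply: le_trans (sum_divisors_le _ _); last first.
  by move=> u v; rewrite mulr_ge0 ?divr_ge0 ?invr_ge0.
apply: ler_sum_nat => m /andP[m0 _] /=.
rewrite natr_sum mulr_suml big_seq [leRHS]big_seq; apply: ler_sum => u.
rewrite -dvdn_divisors // => um.
by rewrite mulrCA -invfM -natrM mulnC divnK.
Qed.

Lemma sum_tauM_div_le (j k X : nat) :
  \sum_(1 <= m < X.+1) (tau j m)%:R * (tau k m)%:R / m%:R <=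
  (\sum_(1 <= m < X.+1) m%:R^-1) ^+ (j.+1 * k.+1) :> R.
Proof.
elim: j => [|j IHj].
  by under eq_bigr do rewrite mul1r; rewrite mul1n sum_tau_div_le.
rewrite mulSn exprD; apply: le_trans (ler_pM _ _ (sum_tau_div_le _ _) IHj).
- rewrite big_distrlr /=.
  apply: le_trans (sum_divisors_le _ _); last first.
    by move=> u v; rewrite !mulr_ge0 ?invr_ge0.
  apply: ler_sum_nat => m /andP[m0 _] /=.
  rewrite natr_sum !mulr_suml big_seq [leRHS]big_seq; apply: ler_sum => u.
  rewrite -dvdn_divisors // => um.
  have [u0 u_le_m] := (dvdn_gt0 m0 um, dvdn_leq m0 um).
  have mu0 : (0 < m %/ u)%N by rewrite divn_gt0.
  rewrite -{2 3}(divnK um) natrM invfM; set v := (m %/ u)%N in mu0 *.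
  have -> : (tau k u)%:R / u%:R * ((tau j v)%:R * (tau k v)%:R / v%:R) =
      (tau j v)%:R * (tau k v * tau k u)%:R * (v%:R^-1 / u%:R) :> R.
    by rewrite natrM; ring.
  by rewrite ler_wpM2r ?mulr_ge0 ?invr_ge0 // ler_wpM2l // ler_nat tauM_le.
- by apply: sumr_ge0 => m _; rewrite mulr_ge0 ?invr_ge0.
- by apply: sumr_ge0 => m _; rewrite !mulr_ge0 ?invr_ge0.
Qed.

Lemma mean_tau_sqr_le (k X : nat) :
  mean X (fun m => (tau k m)%:R ^+ 2) <=
  (\sum_(1 <= m < X.+1) m%:R^-1) ^+ (k.+1 ^ 2) :> R.
Proof.
apply: le_trans (sum_tauM_div_le k k X); rewrite /mean mulr_suml.
apply: ler_sum_nat => m /andP[m0 mX]; rewrite -expr2 ler_wpM2l ?sqr_ge0 //.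
by rewrite lef_pV2 ?posrE ?ltr0n ?ler_nat // (leq_trans m0).
Qed.

End DivisorSums.

(** * Exponential sums *)

Section ComplexModulus.
Context {R : rcfType}.
Implicit Types z w : R[i].

Lemma normc_ge0 z : 0 <= normc z.
Proof. exact: (@normr_ge0 _ (Rcomplex R)). Qed.

Lemma normc_sum (I : Type) (r : seq I) (P : pred I) (F : I -> R[i]) :
  normc (\sum_(i <- r | P i) F i) <= \sum_(i <- r | P i) normc (F i).
Proof. exact: (@ler_norm_sum _ (Rcomplex R)). Qed.

Lemma normc_conj z : normc (conjc z) = normc z.
Proof. by case: z => a b; rewrite /= sqrrN. Qed.

Lemma Re_le_normc z : complex.Re z <= normc z.
Proof.
case: z => a b /=; apply: le_trans (ler_norm _) _.
by rewrite -sqrtr_sqr ler_wsqrtr // lerDl sqr_ge0.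
Qed.

Lemma Re_sum (I : Type) (r : seq I) (P : pred I) (F : I -> R[i]) :
  complex.Re (\sum_(i <- r | P i) F i) = \sum_(i <- r | P i) complex.Re (F i).
Proof. by apply: (big_morph (@complex.Re R)) => // -[a b] [c d]. Qed.

Lemma sqr_normc_Re z : normc z ^+ 2 = complex.Re (z * conjc z).
Proof.
case: z => a b /=; rewrite sqr_sqrtr ?addr_ge0 ?sqr_ge0 //.
by rewrite mulrN opprK !expr2.
Qed.

Lemma sqr_normcD z w :
  normc (z + w) ^+ 2 =
  normc z ^+ 2 + normc w ^+ 2 + 2 * complex.Re (w * conjc z).
Proof. by rewrite !sqr_normc_Re; case: z w => [a b] [c d] /=; ring. Qed.

Lemma exists_phase z :
  exists2 c : R[i], normc c <= 1 & complex.Re (c * z) = normc z.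
Proof.
have [->|z0] := eqVneq z 0.
  by exists 0; rewrite ComplexField.Normc.normc0 // mulr0.
have nz : normc z != 0.
  by apply: contra_neq z0; exact: ComplexField.Normc.eq0_normc.
exists (((normc z)^-1)%:C%C * conjc z).
  rewrite ComplexField.Normc.normcM normc_conj /= expr0n addr0 sqrtr_sqr.
  by rewrite ger0_norm ?invr_ge0 ?normc_ge0 // mulVf.
rewrite -mulrA [conjc z * z]mulrC.
have -> : complex.Re (((normc z)^-1)%:C%C * (z * conjc z)) =
          (normc z)^-1 * complex.Re (z * conjc z).
  by case: (z * conjc z) => a b /=; rewrite mul0r subr0.
by rewrite -sqr_normc_Re expr2 mulKf.
Qed.

End ComplexModulus.

Section Correlations.
Context {R : rcfType}.

Lemma sum_below_diagonal (V : nmodType) (G : nat -> nat -> V) (L : nat) :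
  \sum_(0 <= v < L) \sum_(0 <= u < v) G v u =
  \sum_(1 <= h < L) \sum_(0 <= u < L - h) G (u + h)%N u.
Proof.
elim: L => [|L IHL]; first by rewrite !big_geq.
rewrite big_nat_recr //= IHL.
rewrite [RHS](eq_big_nat _ _ (F2 := fun h =>
  \sum_(0 <= u < L - h) G (u + h)%N u + G L (L - h)%N)); last first.
  by move=> h /andP[_ hL]; rewrite subSn // big_nat_recr //= subnK.
rewrite big_split /=; congr (_ + _).
  case: L {IHL} => [|L]; first by rewrite !big_geq.
  by rewrite [RHS]big_nat_recr //= subnn [X in _ = _ + X]big_geq // addr0.
rewrite big_nat_rev /= add0n big_add1 /=.
by apply: eq_big_nat => u /andP[_ uL].
Qed.

Lemma sqr_normc_sum (F : nat -> R[i]) (L : nat) :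
  normc (\sum_(0 <= u < L) F u) ^+ 2 =
  \sum_(0 <= u < L) normc (F u) ^+ 2 +
  2 * \sum_(1 <= h < L) \sum_(0 <= u < L - h)
        complex.Re (F (u + h)%N * conjc (F u)).
Proof.
rewrite -(sum_below_diagonal (fun v u => complex.Re (F v * conjc (F u)))).
elim: L => [|L IHL].
  by rewrite !big_geq // mulr0 addr0 ComplexField.Normc.normc0 expr0n.
rewrite !big_nat_recr //= sqr_normcD IHL.
have -> : complex.Re (F L * conjc (\sum_(0 <= u < L) F u)) =
    \sum_(0 <= u < L) complex.Re (F L * conjc (F u)).
  by rewrite rmorph_sum mulr_sumr Re_sum.
by ring.
Qed.

Lemma sqr_normc_sum_le (F : nat -> R[i]) (L : nat) :
  (forall u, normc (F u) <= 1) ->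
  normc (\sum_(0 <= u < L) F u) ^+ 2 <= L%:R +
  2 * \sum_(1 <= h < L) normc (\sum_(0 <= u < L - h) F (u + h)%N * conjc (F u)).
Proof.
move=> F1; rewrite sqr_normc_sum; apply: lerD.
  apply: (@le_trans _ _ (\sum_(0 <= u < L) 1)); last first.
    by rewrite sumr_const_nat subn0.
  by apply: ler_sum => u _; rewrite exprn_ile1 ?normc_ge0.
by rewrite ler_wpM2l //; apply: ler_sum => h _; rewrite -Re_sum Re_le_normc.
Qed.

Lemma sum_sqr_normc_sum_le (I : Type) (r : seq I) (F : I -> nat -> R[i])
    (L : nat) :
  (forall i k, normc (F i k) <= 1) ->
  \sum_(i <- r) normc (\sum_(0 <= k < L) F i k) ^+ 2 <=
  (size r)%:R * L%:R + 2 * \sum_(1 <= h < L) \sum_(0 <= k < L - h)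
    normc (\sum_(i <- r) F i (k + h)%N * conjc (F i k)).
Proof.
move=> F1; under eq_bigr do rewrite sqr_normc_sum.
rewrite big_split /= -mulr_sumr; apply: lerD.
  apply: (@le_trans _ _ (\sum_(i <- r) \sum_(0 <= k < L) 1)).
    apply: ler_sum => i _; apply: ler_sum => k _.
    by rewrite exprn_ile1 ?normc_ge0.
  rewrite big_const_seq count_predT iter_addr_0 sumr_const_nat subn0.
  by rewrite mulr_natl.
rewrite exchange_big ler_wpM2l //=; apply: ler_sum => h _.
by rewrite exchange_big; apply: ler_sum => k _; rewrite -Re_sum Re_le_normc.
Qed.

Lemma exists_phases (I J : Type) (r : seq I) (r' : seq J) (P : pred J)
    (G : I -> J -> R[i]) :
  exists2 c : I -> R[i], forall i, normc (c i) <= 1 &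
  \sum_(i <- r) normc (\sum_(j <- r' | P j) G i j) <=
  \sum_(j <- r' | P j) normc (\sum_(i <- r) c i * G i j).
Proof.
pose S i := \sum_(j <- r' | P j) G i j.
have /choice[c cP] i :
    exists c, normc c <= 1 /\ complex.Re (c * S i) = normc (S i).
  by have [c] := exists_phase (S i); exists c.
exists c => [i|]; first by have [] := cP i.
apply: le_trans (normc_sum _ _ _); apply: le_trans (Re_le_normc _).
rewrite exchange_big Re_sum /=; apply: ler_sum => i _.
by have [_ <-] := cP i; rewrite mulr_sumr.
Qed.

End Correlations.

Section AdditiveCharacter.
Context {R : realType}.
Implicit Types s t x : R.

Lemma e0 : e (0 : R) = 1.
Proof. by rewrite /e mulr0 cos0 sin0. Qed.

Lemma eD s t : e (s + t) = e s * e t.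
Proof.
rewrite /e mulrDr cosD sinD; apply/eqP; rewrite eq_complex /= eqxx /=.
by rewrite addrC [X in X + _]mulrC [X in _ + X]mulrC addrC eqxx.
Qed.

Lemma eN t : e (- t) = conjc (e t).
Proof. by rewrite /e mulrN cosN sinN. Qed.

Lemma eB s t : e (s - t) = e s * conjc (e t).
Proof. by rewrite eD eN. Qed.

Lemma normc_e t : normc (e t) = 1.
Proof. by rewrite /e /= cos2Dsin2 sqrtr1. Qed.

Lemma e_nat (m : nat) : e (m%:R : R) = 1.
Proof.
elim: m => [|m IHm]; first exact: e0.
rewrite -natr1 eD IHm mul1r /e mulr1.
by rewrite (_ : 2 * pi = pi *+ 2) ?cos2pi ?sin2pi // mulr_natl.
Qed.

Lemma e_int (m : int) : e (m%:~R : R) = 1.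
Proof.
case: m => m; first exact: e_nat.
by rewrite NegzE mulrNz eN e_nat conjc1.
Qed.

(* Jordan's inequality: the slopes of sin on [0, x] and on [x, pi/2] are values
   of cos at c1 < c2, and cos is decreasing. *)
Lemma le_pihalf_sin x : 0 <= x <= pi / 2 -> x <= pi / 2 * sin x.
Proof.
move=> /andP[]; rewrite le_eqVlt => /predU1P[<- _|x0].
  by rewrite sin0 mulr0.
rewrite le_eqVlt => /predU1P[->|x_lt]; first by rewrite sin_pihalf mulr1.
have MVT_sin (a b : R) : a < b ->
    exists2 c, c \in `]a, b[ & sin b - sin a = cos c * (b - a).
  by move=> ab; apply: MVT => //; exact/continuous_subspaceT/continuous_sin.
have [c1 + sin_left] := MVT_sin _ _ x0.
have [c2 + sin_right] := MVT_sin _ _ x_lt.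
rewrite !in_itv /= => /andP[c2l c2r] /andP[c1l c1r].
have pihalf2 : pi / 2 <= pi :> R by have := pi_ge0 R; lra.
have cosc : cos c2 <= cos c1.
  apply/ltW; rewrite ltr_cos ?in_itv //=; lra.
move: sin_left sin_right; rewrite sin0 sin_pihalf !subr0 => sin_left sin_right.
have chords : x * (1 - sin x) <= sin x * (pi / 2 - x).
  rewrite sin_right sin_left [cos c1 * x]mulrC -mulrA.
  by rewrite ler_wpM2l ?(ltW x0) // ler_wpM2r //; lra.
by lra.
Qed.

Lemma normc_1Be t : normc (1 - e t) = 2 * `|sin (pi * t)|.
Proof.
rewrite /e /= -mulrA mulr_natl cos_mulr2n sin_mulr2n.
apply/eqP; rewrite -(@eqrXn2 _ 2) ?sqrtr_ge0 ?mulr_ge0 //.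
rewrite sqr_sqrtr ?addr_ge0 ?sqr_ge0 // exprMn real_normK ?num_real //.
have := cos2Dsin2 (pi * t); set c := cos _; set s := sin _ => cs.
have -> : (0 - (c * s) *+ 2) ^+ 2 = 4 * c ^+ 2 * s ^+ 2 by ring.
have -> : c ^+ 2 = 1 - s ^+ 2 by lra.
by apply/eqP; ring.
Qed.

Definition dist_int t : R := `|t - (Num.floor (t + 2^-1))%:~R|.

Lemma dist_int_ge0 t : 0 <= dist_int t.
Proof. exact: normr_ge0. Qed.

Lemma dist_int_le_half t : dist_int t <= 2^-1.
Proof.
have := floor_itv (t + 2^-1); rewrite intrD => /andP[m1 m2].
by rewrite ler_norml; apply/andP; split; lra.
Qed.

Lemma dist_int_le_normc_1Be t : 4 * dist_int t <= normc (1 - e t).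
Proof.
have := dist_int_le_half t; have := dist_int_ge0 t.
rewrite /dist_int; set m := Num.floor _; set w := t - _ => w0 w2.
have -> : e t = e w by rewrite /w eD -mulrNz e_int mulr1.
rewrite normc_1Be.
have -> : `|sin (pi * w)| = `|sin (pi * `|w|)|.
  by case: (ler0P w) => // _; rewrite mulrN sinN normrN.
have pi0 := pi_gt0 R.
have /le_pihalf_sin : 0 <= pi * `|w| <= pi / 2 by apply/andP; split; nra.
have := ler_norm (sin (pi * `|w|)); nra.
Qed.

Lemma normc_sum_e_le (A L : nat) (phi : nat -> R) :
  normc (\sum_(A <= u < A + L) e (phi u)) <= L%:R.
Proof.
apply: le_trans (normc_sum _ _ _) _; under eq_bigr do rewrite normc_e.
by rewrite sumr_const_nat addKn.
Qed.

Lemma normc_sum_e_linear_le (b c : R) (A B : nat) :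
  normc (\sum_(A <= u < B) e (b * u%:R + c)) * normc (1 - e b) <= 2.
Proof.
case: (leqP A B) => [AB|/ltnW BA]; last first.
  by rewrite big_geq // ComplexField.Normc.normc0 mul0r.
rewrite -ComplexField.Normc.normcM mulr_suml.
rewrite (eq_bigr (fun u => - (e (b * u.+1%:R + c) - e (b * u%:R + c)))).
  rewrite sumrN normcN telescope_sumr //.
  by apply: le_trans (le_normcD _ _) _; rewrite normcN !normc_e; lra.
move=> u _; rewrite mulrBr mulr1 -eD opprB; congr (_ - e _).
by rewrite -natr1; ring.
Qed.

(* A smooth form of min(1, 1 / (y ||t||)), free of the junk value 1 / 0 = 0. *)
Definition geom_bound (y t : R) : R := 2 / (1 + 2 * y * dist_int t).

Lemma geom_bound_ge0 (y t : R) : 0 <= y -> 0 <= geom_bound y t.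
Proof.
by move=> y0; rewrite divr_ge0 // addr_ge0 // !mulr_ge0 ?dist_int_ge0.
Qed.

Lemma normc_sum_e_linear_le_geom_bound (b c : R) (A L y : nat) :
  (L <= y)%N -> (0 < y)%N ->
  normc (\sum_(A <= u < A + L) e (b * u%:R + c)) / y%:R <= geom_bound y%:R b.
Proof.
move=> Ly y0; have yR0 : 0 < y%:R :> R by rewrite ltr0n.
have Ly' : L%:R <= y%:R :> R by rewrite ler_nat.
have := normc_sum_e_le A L (fun u => b * u%:R + c).
have := normc_sum_e_linear_le b c A (A + L).
set S := normc _ => S_lin S_L; have S0 : 0 <= S by exact: normc_ge0.
have d0 := dist_int_ge0 b.
have S_dist : S * dist_int b <= 2^-1.
  by have := ler_wpM2l S0 (dist_int_le_normc_1Be b); lra.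
rewrite /geom_bound ler_pdivrMr // mulrAC ler_pdivlMr; last by nra.
by nra.
Qed.

(* Linearising the moduli with phases and applying Cauchy's inequality in u
   discards the condition [P u], leaving complete sums over u. *)
Lemma sqr_sum_normc_le (phi : nat -> R) (P : pred nat) (K y A : nat) :
  (\sum_(1 <= k < K.+1)
     normc (\sum_(A <= u < A + y | P u) e (k%:R * phi u))) ^+ 2 <=
  y%:R * K%:R * (y%:R +
    2 * \sum_(1 <= h < K) normc (\sum_(A <= u < A + y) e (h%:R * phi u))).
Proof.
rewrite big_add1 /=.
have [c c1 S_le] := exists_phases (index_iota 0 K) (index_iota A (A + y)) P
  (fun k u => e (k.+1%:R * phi u)).
pose F u k := c k * e (k.+1%:R * phi u).
have F1 u k : normc (F u k) <= 1.
  by rewrite ComplexField.Normc.normcM normc_e mulr1.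
pose W u := normc (\sum_(0 <= k < K) F u k).
apply: (@le_trans _ _ ((\sum_(A <= u < A + y) W u) ^+ 2)).
  apply: lerXn2r; rewrite ?nnegrE.
  - by apply: sumr_ge0 => k _; exact: normc_ge0.
  - by apply: sumr_ge0 => u _; exact: normc_ge0.
  apply: le_trans S_le _; rewrite [leLHS]big_mkcond; apply: ler_sum => u _.
  by case: ifP => // _; exact: normc_ge0.
apply: le_trans (exprn_sum_le _ 1 (fun u => normc_ge0 _)) _.
rewrite expr1 size_iota addKn -mulrA ler_wpM2l //.
apply: le_trans (sum_sqr_normc_sum_le _ _ F1) _.
rewrite size_iota addKn [leRHS]mulrDr mulrC lerD2l.
rewrite mulrCA ler_wpM2l // mulr_sumr; apply: ler_sum => h _.
set T := normc (\sum_(A <= u < A + y) e (h%:R * phi u)).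
have T0 : 0 <= T by exact: normc_ge0.
have correlation_le k :
    normc (\sum_(A <= u < A + y) F u (k + h)%N * conjc (F u k)) <= T.
  rewrite (eq_bigr (fun u => c (k + h)%N * conjc (c k) * e (h%:R * phi u))).
    rewrite -mulr_sumr !ComplexField.Normc.normcM normc_conj ler_piMl //.
    by rewrite mulr_ile1 ?normc_ge0.
  move=> u _; rewrite /F rmorphM mulrACA -eB; congr (_ * e _).
  by rewrite -!natr1 natrD; ring.
apply: le_trans (ler_sum _ (fun k _ => correlation_le k)) _.
rewrite sumr_const_nat subn0 -[T *+ _]mulr_natl.
by rewrite ler_wpM2r // ler_nat leq_subr.
Qed.

Definition mean_exp_sum (phi : nat -> R) (P : pred nat) (A y K : nat) : R :=
  mean K (fun k =>
    normc (\sum_(A <= u < A + y | P u) e (k%:R * phi u)) / y%:R).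

Lemma mean_exp_sum_ge0 phi P A y K : 0 <= mean_exp_sum phi P A y K.
Proof. by apply: mean_ge0 => k; rewrite divr_ge0 ?normc_ge0. Qed.

Lemma sqr_mean_exp_sum_le phi P A y K : (0 < K)%N -> (0 < y)%N ->
  mean_exp_sum phi P A y K ^+ 2 <=
  K%:R^-1 + 2 * mean_exp_sum phi predT A y K.
Proof.
move=> K0 y0; have [KR0 yR0] : 0 < K%:R :> R /\ 0 < y%:R :> R by rewrite !ltr0n.
rewrite /mean_exp_sum /mean -!mulr_suml -mulrA -invfM expr_div_n.
rewrite ler_pdivrMr ?exprn_gt0 ?mulr_gt0 //.
apply: le_trans (sqr_sum_normc_le _ _ _ _ _) _.
set T := \sum_(1 <= h < K) _; set T' := \sum_(1 <= h < K.+1) _.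
have TT' : T <= T' by apply: ler_sum_index_iota => // h; exact: normc_ge0.
have -> : (K%:R^-1 + 2 * (T' / y%:R / K%:R)) * (y%:R * K%:R) ^+ 2 =
    y%:R * K%:R * (y%:R + 2 * T') by field; rewrite !gt_eqF.
by rewrite ler_wpM2l ?mulr_ge0 // lerD2l ler_wpM2l.
Qed.

End AdditiveCharacter.

(** * Weyl differencing *)

Section DifferencePolynomial.
Context {R : comNzRingType}.
Implicit Types (p : {poly R}) (h x : R).

Lemma coef_comp_XaddC p h n : (p \Po ('X + h%:P))`_n = p^`N(n).[h].
Proof.
elim/poly_ind: p n => [|p c IHp] n.
  by rewrite comp_poly0 coef0 linear0 horner0.
rewrite comp_poly_MXaddC mulrDr !coefD coefMX coefMC coefC.
case: n => [|n]; first by rewrite IHp !nderivn0 add0r hornerMXaddC.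
by rewrite !IHp nderivnMXaddC addr0 hornerD hornerMX.
Qed.

Lemma horner_nderivn_wide p x n k : (size p <= n + k)%N ->
  p^`N(n).[x] = \sum_(i < k) p`_(n + i) *+ 'C(n + i, n) * x ^+ i.
Proof.
move=> sp; rewrite (@horner_coef_wide _ k).
  by apply: eq_bigr => i _; rewrite coef_nderivn.
apply/leq_sizeP => j kj; rewrite coef_nderivn nth_default ?mul0rn //.
by rewrite (leq_trans sp) // leq_add2l.
Qed.

Definition diff_poly h p : {poly R} := p \Po ('X + h%:P) - p.

Lemma horner_diff_poly h p x : (diff_poly h p).[x] = p.[x + h] - p.[x].
Proof. by rewrite hornerD hornerN horner_comp !hornerE. Qed.

Lemma size_diff_poly_le h p d :
  (size p <= d.+1)%N -> (size (diff_poly h p) <= d)%N.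
Proof.
move=> sp; apply/leq_sizeP => j dj; rewrite coefB coef_comp_XaddC.
rewrite (@horner_nderivn_wide _ _ _ 1) ?addn1 ?(leq_trans sp) //.
by rewrite big_ord1 addn0 binn expr0 mulr1 subrr.
Qed.

Lemma coef_diff_poly h p d : (size p <= d.+2)%N ->
  (diff_poly h p)`_d = d.+1%:R * h * p`_d.+1.
Proof.
move=> sp; rewrite coefB coef_comp_XaddC.
rewrite (@horner_nderivn_wide _ _ _ 2) ?addn2 //.
rewrite !big_ord_recl big_ord0 /= addn0 addn1 binn binSn expr0 expr1.
by rewrite -mulr_natl; ring.
Qed.

End DifferencePolynomial.

Section WeylInequality.
Context {R : realType}.
Implicit Type p : {poly R}.

Definition weyl_sum p (A L : nat) : R[i] := \sum_(A <= u < A + L) e p.[u%:R].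

Lemma normc_weyl_sum_linear_le p (A L y : nat) :
  (size p <= 2)%N -> (L <= y)%N -> (0 < y)%N ->
  normc (weyl_sum p A L) / y%:R <= geom_bound y%:R p`_1.
Proof.
move=> sp Ly y0.
rewrite /weyl_sum (eq_bigr (fun u => e (p`_1 * u%:R + p`_0))).
  exact: normc_sum_e_linear_le_geom_bound.
move=> u _; congr e; rewrite (@horner_coef_wide _ 2) //.
by rewrite !big_ord_recl big_ord0 expr0 expr1 /=; ring.
Qed.

Lemma sqr_normc_weyl_sum_le p (A L y : nat) : (L <= y)%N ->
  normc (weyl_sum p A L) ^+ 2 <= y%:R +
  2 * \sum_(1 <= h < y.+1) normc (weyl_sum (diff_poly h%:R p) A (L - h)).
Proof.
have shift q M : weyl_sum q A M = \sum_(0 <= u < M) e q.[(u + A)%:R].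
  by rewrite /weyl_sum -{1}[A]add0n big_addn addKn.
move=> Ly; rewrite shift; apply: le_trans (sqr_normc_sum_le _ _) _.
  by move=> u; rewrite normc_e.
rewrite lerD ?ler_nat // ler_wpM2l //.
have -> : \sum_(1 <= h < L) normc (\sum_(0 <= u < L - h)
      e p.[(u + h + A)%:R] * conjc (e p.[(u + A)%:R])) =
    \sum_(1 <= h < L) normc (weyl_sum (diff_poly h%:R p) A (L - h)).
  apply: eq_bigr => h _; rewrite shift; congr normc; apply: eq_bigr => u _.
  by rewrite horner_diff_poly -eB addnAC natrD.
by apply: ler_sum_index_iota => [|h]; [rewrite leqW|exact: normc_ge0].
Qed.

Lemma sqr_normc_weyl_sum_mean_le p (A L y : nat) : (L <= y)%N -> (0 < y)%N ->
  (normc (weyl_sum p A L) / y%:R) ^+ 2 <= y%:R^-1 +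
  2 * mean y (fun h => normc (weyl_sum (diff_poly h%:R p) A (L - h)) / y%:R).
Proof.
move=> Ly y0; have yR0 : 0 < y%:R :> R by rewrite ltr0n.
rewrite expr_div_n ler_pdivrMr ?exprn_gt0 //.
rewrite /mean -mulr_suml [leRHS](_ : _ = y%:R +
    2 * \sum_(1 <= h < y.+1) normc (weyl_sum (diff_poly h%:R p) A (L - h))).
  exact: sqr_normc_weyl_sum_le.
by field; rewrite gt_eqF.
Qed.

(* The average over h_1, ..., h_s <= y of the geometric bound at
   (s+1)! h_1 ... h_s b, the slope left after s differencing steps. *)
Fixpoint weyl_mean (y s : nat) (b : R) : R :=
  if s is s'.+1 then mean y (fun h => weyl_mean y s' (s'.+2%:R * h%:R * b))
  else geom_bound y%:R b.

Lemma weyl_mean_ge0 (y s : nat) (b : R) : 0 <= weyl_mean y s b.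
Proof.
by elim: s b => [|s IHs] b; [exact: geom_bound_ge0|exact: mean_ge0].
Qed.

Fixpoint weyl_const (s : nat) : R :=
  if s is s'.+1 then 4 ^+ (2 ^ s') * (1 + weyl_const s') else 1.

Lemma weyl_inequality s p (A L y : nat) :
  (size p <= s.+2)%N -> (L <= y)%N -> (0 < y)%N ->
  (normc (weyl_sum p A L) / y%:R) ^+ (2 ^ s) <=
  weyl_const s * (y%:R^-1 + weyl_mean y s p`_s.+1).
Proof.
move=> + + y0; elim: s p L => [|s IHs] p L sp Ly.
  rewrite expn0 expr1 mul1r.
  apply: le_trans (normc_weyl_sum_linear_le A sp Ly y0) _.
  by rewrite lerDr invr_ge0.
set N := (2 ^ s)%N in IHs.
have N0 : (0 < N)%N by rewrite expn_gt0.
pose t h := normc (weyl_sum (diff_poly h%:R p) A (L - h)) / y%:R.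
have t0 h : 0 <= t h by rewrite divr_ge0 ?normc_ge0.
have yV0 : 0 <= y%:R^-1 :> R by rewrite invr_ge0.
have mean_tN : mean y (fun h => t h ^+ N) <=
    weyl_const s * (y%:R^-1 + weyl_mean y s.+1 p`_s.+2).
  rewrite /= -meanDl // -meanZ; apply: ler_mean => h _.
  rewrite -(coef_diff_poly h%:R sp); apply: IHs; first exact: size_diff_poly_le.
  exact: leq_trans (leq_subr _ _) Ly.
have sqr_le := sqr_normc_weyl_sum_mean_le p A Ly y0.
rewrite expnS; apply: le_trans (exprn_double_le N yV0 (mean_ge0 _ t0) sqr_le) _.
rewrite -[leRHS]mulrA ler_wpM2l ?exprn_ge0 // mulrDl mul1r.
have yVN : y%:R^-1 ^+ N <= y%:R^-1 :> R.
  by rewrite ler_iXnr // invf_le1 ?ler1n ?ltr0n.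
apply: lerD; last by apply: le_trans mean_tN; exact: exprn_mean_le.
by apply: le_trans yVN _; rewrite lerDl weyl_mean_ge0.
Qed.

Lemma mean_weyl_mean_le (y s J : nat) (b : R) :
  mean J (fun j => weyl_mean y s (j%:R * b)) <=
  mean (J * y ^ s) (fun m =>
    (tau s m)%:R * geom_bound y%:R (((s.+1)`! * m)%:R * b)).
Proof.
elim: s b => [|s IHs] b.
  by rewrite muln1; apply: ler_mean => j _; rewrite mul1r mul1n.
rewrite exchange_mean expnS mulnCA.
pose F h m := (tau s m)%:R * geom_bound y%:R ((s.+2`! * (h * m))%:R * b).
have F0 h m : 0 <= F h m by rewrite mulr_ge0 // geom_bound_ge0.
apply: (@le_trans _ _ (mean y (fun h => mean (J * y ^ s) (F h)))).
  apply: ler_mean => h _.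
  rewrite (eq_mean (G := fun j => weyl_mean y s (j%:R * (s.+2%:R * h%:R * b)))).
    apply: le_trans (IHs _) _; apply: ler_mean => m _; rewrite /F.
    rewrite (_ : _ * (_ * b) = (s.+2`! * (h * m))%:R * b) //.
    by rewrite factS !natrM; ring.
  by move=> j _; congr weyl_mean; ring.
apply: le_trans (mean_mean_le_divisors _ _ F0) _.
apply: ler_mean => m /andP[m0 _].
rewrite /= natr_sum mulr_suml big_seq [leRHS]big_seq; apply: ler_sum => u.
rewrite -dvdn_divisors // => um.
by rewrite /F [(u * _)%N]mulnC divnK.
Qed.

End WeylInequality.

(** * Averages along a rational approximation *)

Section ResidueBound.
Context {R : realFieldType}.
Variables (y q : R).
Hypotheses (y0 : 0 < y) (q0 : 0 < q).

(* [geom_bound y t] at a point with [||t|| = l / q]. *)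
Definition residue_bound (l : nat) : R := 2 * q / (q + 2 * y * l%:R).

Lemma residue_bound0 : residue_bound 0 = 2.
Proof. by rewrite /residue_bound mulr0 addr0 mulfK // gt_eqF. Qed.

(* The term at l+1 is at most f(l) - f(l+1), f(l) = 2 q^2 / (y (q + 2 y l)). *)
Lemma sum_residue_bound_sqr_le n :
  \sum_(0 <= l < n) residue_bound l ^+ 2 <= 4 + 2 * (q / y).
Proof.
have d0 l : 0 < q + 2 * y * l%:R.
  by rewrite ltr_pwDl // !mulr_ge0 // ltW.
pose f l : R := 2 * q ^+ 2 / (y * (q + 2 * y * l%:R)).
have f0 l : 0 <= f l by rewrite divr_ge0 ?mulr_ge0 ?exprn_ge0 // ltW.
have f00 : f 0%N = 2 * (q / y).
  by rewrite /f mulr0 addr0; field; rewrite !gt_eqF.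
suff : \sum_(0 <= l < n.+1) residue_bound l ^+ 2 <= 4 + (f 0%N - f n).
  rewrite f00 big_nat_recr //=.
  by have := f0 n; have := sqr_ge0 (residue_bound n); lra.
elim: n => [|n IHn].
  by rewrite big_nat1 subrr addr0 residue_bound0; lra.
rewrite big_nat_recr //=.
suff : residue_bound n.+1 ^+ 2 <= f n - f n.+1 by lra.
have -> : f n - f n.+1 =
    (2 * q) ^+ 2 / ((q + 2 * y * n%:R) * (q + 2 * y * n.+1%:R)).
  by rewrite /f; field; rewrite nat1r !gt_eqF.
rewrite /residue_bound expr_div_n ler_wpM2l ?sqr_ge0 //.
rewrite lef_pV2 ?posrE ?exprn_gt0 ?mulr_gt0 // expr2 ler_wpM2r ?(ltW (d0 _)) //.
by rewrite lerD2l ler_wpM2l ?ler_nat // mulr_ge0 // ltW.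
Qed.

Lemma sum_residue_bound_shift_le n :
  \sum_(0 <= l < n) residue_bound (l - 2) ^+ 2 <= 12 * (1 + q / y).
Proof.
apply: (@le_trans _ _ (\sum_(0 <= l < n.+2) residue_bound (l - 2) ^+ 2)).
  by apply: ler_sum_index_iota => [|l]; [rewrite !leqW|exact: sqr_ge0].
rewrite !big_nat_recl //= !sub0n residue_bound0.
under eq_bigr do rewrite subn2 /=.
have : 0 <= q / y by rewrite divr_ge0 // ltW.
by have := sum_residue_bound_sqr_le n; lra.
Qed.

Lemma sum_residue_bound_sym_le (n : nat) :
  \sum_(0 <= l < n)
     (residue_bound (l - 2) ^+ 2 + residue_bound (n - l - 2) ^+ 2) <=
  24 * (1 + q / y).
Proof.
rewrite big_split /=.
have : \sum_(0 <= l < n) residue_bound (n - l - 2) ^+ 2 <= 12 * (1 + q / y).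
  apply: le_trans (sum_residue_bound_shift_le n.+1).
  rewrite big_nat_rev add0n [leRHS]big_nat_recl //= ler_wpDl ?sqr_ge0 //.
  by apply: ler_sum_nat => l /andP[_ ln]; rewrite subKn.
by have := sum_residue_bound_shift_le n; lra.
Qed.

End ResidueBound.

Lemma sum_affine_mod (V : nmodType) (F : nat -> V) (a c : int) (q : nat) :
  (0 < q)%N -> coprimez a q%:Z ->
  \sum_(0 <= r < q) F `|((c + a * r%:Z) %% q%:Z)%Z|%N = \sum_(0 <= l < q) F l.
Proof.
move=> q0 aq.
have mod_lt r : (`|((c + a * r%:Z) %% q%:Z)%Z| < q)%N.
  have := ltz_pmod (c + a * r%:Z) (_ : (0 < q%:Z)%R).
  by have := modz_ge0 (c + a * r%:Z) (_ : q%:Z != 0); lia.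
pose affine (r : 'I_q) : 'I_q := Ordinal (mod_lt r).
have affine_inj : injective affine.
  move=> r r' /(congr1 val) /= mod_eq; apply: val_inj => /=.
  have : (c + a * r%:Z == c + a * r'%:Z %[mod q%:Z])%Z.
    by rewrite -[X in X == _]gez0_abs ?mod_eq ?gez0_abs // modz_ge0 //; lia.
  rewrite eqz_modDl -!(mulrC _ a) eqz_mod_dvd -mulrBl Gauss_dvdzl; last first.
    by rewrite coprimez_sym.
  by rewrite -eqz_mod_dvd !modz_nat !modn_small // => /eqP[].
by rewrite !big_mkord [RHS](reindex_inj affine_inj).
Qed.

Section RationalApproximation.
Context {R : realType}.

Lemma dist_int_near_fraction (q : nat) (c : int) (delta t : R) :
  (0 < q)%N -> q%:R * t = c%:~R + delta ->
  let s := `|(c %% q%:Z)%Z|%N in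
  s%:R - `|delta| <= q%:R * dist_int t \/
  q%:R - s%:R - `|delta| <= q%:R * dist_int t.
Proof.
move=> q0 qt s; have qR0 : 0 < q%:R :> R by rewrite ltr0n.
rewrite /dist_int; set m := Num.floor _.
pose d := (c %/ q%:Z)%Z.
have cE : c = d * q%:Z + s%:Z.
  by rewrite [s%:Z]gez0_abs ?modz_ge0 -?divz_eq //; lia.
have -> : q%:R * `|t - m%:~R| = `|(d - m)%:~R * q%:R + s%:R + delta|.
  rewrite -{1}(ger0_norm (ltW qR0)) -normrM mulrBr qt cE !intrD intrM mulrNz.
  by congr `| _ |; ring.
set w := _ + delta; have [wl wr] := (ler_norm w, ler_norm (- w)).
rewrite normrN in wr; have [dl dr] := (ler_norm delta, ler_norm (- delta)).
rewrite normrN in dr; case: (lerP m d) => md; [left|right].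
  have : 0 <= (d - m)%:~R :> R by rewrite ler0z subr_ge0.
  by rewrite /w in wl wr *; nra.
have : (d - m)%:~R <= (-1)%:~R :> R by rewrite ler_int; lia.
by rewrite mulrN1z; rewrite /w in wl wr *; nra.
Qed.

Lemma geom_bound_le_residue_bound (y t : R) (q l : nat) :
  0 < y -> (0 < q)%N -> l%:R - 2 <= q%:R * dist_int t ->
  geom_bound y t <= residue_bound y q%:R (l - 2).
Proof.
move=> y0 q0 l_le; have qR0 : 0 < q%:R :> R by rewrite ltr0n.
have dq0 : 0 <= q%:R * dist_int t by rewrite mulr_ge0 ?dist_int_ge0.
have {}l_le : (l - 2)%:R <= q%:R * dist_int t.
  by case: (leqP 2 l) => [l2|/ltnW/eqP ->] //; rewrite natrB.
have l0 : 0 <= (l - 2)%:R :> R by [].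
have -> : geom_bound y t = 2 * q%:R / (q%:R + 2 * y * (q%:R * dist_int t)).
  rewrite /geom_bound; have d0 := dist_int_ge0 t.
  by field; apply/andP; split; [nra|nra].
rewrite ler_wpM2l ?mulr_ge0 // lef_pV2 ?posrE; [|nra|nra].
by rewrite lerD2l ler_wpM2l // mulr_ge0 // ltW.
Qed.

Section Approximation.
Variables (a : int) (q : nat) (theta alpha y : R).
Hypotheses (q0 : (0 < q)%N) (y0 : 0 < y) (aq : coprimez a q%:Z).
Hypothesis theta1 : `|theta| <= 1.
Hypothesis alphaE : alpha = a%:~R / q%:R + theta / q%:R ^+ 2.

Let qR0 : 0 < q%:R :> R. Proof. by rewrite ltr0n. Qed.

Lemma rational_approx_block (m r : nat) : (r < q)%N ->
  exists2 delta : R, `|delta| <= 2 &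
  q%:R * (alpha * (m + r)%:R) =
    (Num.floor (q%:R * (alpha * m%:R)) + a * r%:Z)%:~R + delta.
Proof.
move=> rq; set c := Num.floor _.
have /andP[c1 c2] := floor_itv (q%:R * (alpha * m%:R)).
rewrite -/c intrD in c1 c2.
exists (q%:R * (alpha * m%:R) - c%:~R + theta * (r%:R / q%:R)).
  have rq1 : r%:R / q%:R <= 1 :> R by rewrite ler_pdivrMr // mul1r ler_nat ltnW.
  have rq0 : 0 <= r%:R / q%:R :> R by rewrite divr_ge0.
  move: theta1; rewrite !ler_norml => /andP[t1 t2].
  by apply/andP; split; nra.
rewrite intrD intrM natrD mulrDr [alpha in alpha * r%:R]alphaE.
by field; rewrite gt_eqF.
Qed.

Let block_residue (m r : nat) : nat :=
  `|((Num.floor (q%:R * (alpha * m%:R)) + a * r%:Z) %% q%:Z)%Z|.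

Let block_residue_le m r : (block_residue m r <= q)%N.
Proof.
rewrite /block_residue; set b := _ + a * r%:Z.
have := ltz_pmod b (_ : (0 < q%:Z)%R); have := modz_ge0 b (_ : q%:Z != 0).
by lia.
Qed.

Lemma geom_bound_block_le (m r : nat) : (r < q)%N ->
  geom_bound y (alpha * (m + r)%:R) ^+ 2 <=
  residue_bound y q%:R (block_residue m r - 2) ^+ 2 +
  residue_bound y q%:R (q - block_residue m r - 2) ^+ 2.
Proof.
move=> rq; set s := block_residue m r.
have [delta delta2 tE] := rational_approx_block m rq.
have g0 := geom_bound_ge0 (alpha * (m + r)%:R) (ltW y0).
have sq : (s <= q)%N by exact: block_residue_le.
have sqr_le l : l%:R - 2 <= q%:R * dist_int (alpha * (m + r)%:R) ->
    geom_bound y (alpha * (m + r)%:R) ^+ 2 <=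
    residue_bound y q%:R (l - 2) ^+ 2.
  move=> /(geom_bound_le_residue_bound y0 q0) g_le.
  by apply: lerXn2r; rewrite ?nnegrE // (le_trans g0).
have [s_le|s_le] := dist_int_near_fraction q0 tE;
  rewrite -/(block_residue m r) -/s in s_le.
  by rewrite ler_wpDr ?sqr_ge0 // sqr_le //; lra.
by rewrite ler_wpDl ?sqr_ge0 // sqr_le // natrB //; lra.
Qed.

Lemma sum_geom_bound_block_le (m : nat) :
  \sum_(0 <= r < q) geom_bound y (alpha * (m + r)%:R) ^+ 2 <=
  24 * (1 + q%:R / y).
Proof.
apply: le_trans (sum_residue_bound_sym_le y0 qR0 q).
rewrite -[leRHS](sum_affine_mod _ (Num.floor (q%:R * (alpha * m%:R))) q0 aq).
apply: ler_sum_nat => r /andP[_ rq]; exact: geom_bound_block_le.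
Qed.

Lemma sum_geom_bound_sqr_le (M : nat) :
  \sum_(1 <= m < M.+1) geom_bound y (alpha * m%:R) ^+ 2 <=
  24 * (M%:R / q%:R + 1) * (1 + q%:R / y).
Proof.
pose B := (M %/ q).+1.
have MB : (M < B * q)%N by rewrite ltn_ceil.
apply: (@le_trans _ _ (\sum_(0 <= m < B * q) geom_bound y (alpha * m%:R) ^+ 2)).
  apply: le_trans (ler_sum_index_iota 0 MB _) => [|m]; last exact: sqr_ge0.
  by rewrite [leRHS]big_ltn // lerDr sqr_ge0.
rewrite big_nat_mul.
apply: (@le_trans _ _ (\sum_(0 <= i < B) 24 * (1 + q%:R / y))).
  apply: ler_sum => i _; rewrite mulSn -{1}[(i * q)%N]add0n big_addn addnK.
  under eq_bigr do rewrite addnC.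
  exact: sum_geom_bound_block_le.
rewrite sumr_const_nat subn0 -[leLHS]mulr_natr mulrAC ler_wpM2r //.
  by rewrite addr_ge0 ?divr_ge0 // ltW.
rewrite ler_wpM2l // /B -natr1 lerD2r ler_pdivlMr // -natrM ler_nat.
exact: leq_divM.
Qed.

Lemma mean_geom_bound_sqr_le (d X : nat) : (0 < d)%N -> (0 < X)%N ->
  mean X (fun m => geom_bound y ((d * m)%:R * alpha) ^+ 2) <=
  24 * d%:R * ((q%:R^-1 + X%:R^-1) * (1 + q%:R / y)).
Proof.
move=> d0 X0; have XR0 : 0 < X%:R :> R by rewrite ltr0n.
have d1 : 1 <= d%:R :> R by rewrite ler1n.
have qy0 : 0 <= 1 + q%:R / y by rewrite addr_ge0 ?divr_ge0 // ltW.
rewrite ler_pdivrMr //.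
pose g2 m := geom_bound y (alpha * m%:R) ^+ 2.
apply: (@le_trans _ _ (\sum_(1 <= m < (d * X).+1) g2 m)).
  under eq_bigr do rewrite mulrC.
  rewrite -(big_map (muln d) xpredT g2).
  apply: ler_sum_uniq_sub => [||m]; last exact: sqr_ge0.
    rewrite map_inj_uniq ?iota_uniq // => i j /eqP.
    by rewrite eqn_pmul2l // => /eqP.
  move=> _ /mapP[m + ->]; rewrite !mem_index_iota => /andP[m0 mX].
  by rewrite muln_gt0 d0 m0 ltnS leq_pmul2l.
apply: le_trans (sum_geom_bound_sqr_le _) _.
have -> : 24 * d%:R * ((q%:R^-1 + X%:R^-1) * (1 + q%:R / y)) * X%:R =
    24 * ((d * X)%:R / q%:R + d%:R) * (1 + q%:R / y).
  by rewrite natrM; field; rewrite !gt_eqF.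
by rewrite ler_wpM2r // ler_wpM2l // lerD2l.
Qed.

End Approximation.

End RationalApproximation.

(** * Mean values of complete sums *)

Section ErrorFactor.
Context {R : realFieldType}.

Definition error_factor (n K y q : nat) : R :=
  1 / q%:R + 1 / y%:R + q%:R / (K%:R * y%:R ^+ n) + 1 / K%:R ^+ (2 ^ n.-1).

Lemma error_factor_ge0 n K y q : 0 <= error_factor n K y q.
Proof. by rewrite !addr_ge0 // divr_ge0 // mulr_ge0 // exprn_ge0. Qed.

Lemma invy_le_error_factor n K y q : y%:R^-1 <= error_factor n K y q.
Proof.
rewrite /error_factor [1 / y%:R]div1r -!addrA addrCA lerDl.
by rewrite !addr_ge0 // divr_ge0 // ?mulr_ge0 // exprn_ge0.
Qed.

Lemma invK_le_error_factor n K y q :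
  (K%:R ^+ (2 ^ n.-1))^-1 <= error_factor n K y q.
Proof.
rewrite /error_factor [1 / K%:R ^+ _]div1r lerDr.
by rewrite !addr_ge0 // divr_ge0 // mulr_ge0 // exprn_ge0.
Qed.

Lemma cross_terms_le_error_factor s K y q :
  (0 < K)%N -> (0 < y)%N -> (0 < q)%N ->
  (q%:R^-1 + (K%:R * y%:R ^+ s)^-1) * (1 + q%:R / y%:R) <=
  2 * error_factor s.+1 K y q.
Proof.
move=> K0 y0 q0.
have [KR0 yR0] : 0 < K%:R :> R /\ 0 < y%:R :> R by rewrite !ltr0n.
have qR0 : 0 < q%:R :> R by rewrite ltr0n.
have yR1 : 1 <= y%:R :> R by rewrite ler1n.
have KysV : (K%:R * y%:R ^+ s)^-1 <= y%:R^-1 + (K%:R ^+ (2 ^ s))^-1 :> R.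
  case: s => [|s]; first by rewrite expr0 mulr1 expn0 expr1 lerDr invr_ge0.
  apply: (@le_trans _ _ y%:R^-1); last by rewrite lerDl invr_ge0 exprn_ge0.
  rewrite lef_pV2 ?posrE ?mulr_gt0 ?exprn_gt0 //.
  rewrite -[leLHS]mul1r ler_pM // ?ler1n //.
  by rewrite exprS ler_peMr // exprn_ege1.
have -> : (q%:R^-1 + (K%:R * y%:R ^+ s)^-1) * (1 + q%:R / y%:R) =
    q%:R^-1 + y%:R^-1 + (K%:R * y%:R ^+ s)^-1 +
    q%:R / (K%:R * y%:R ^+ s.+1) :> R.
  by rewrite exprS; field; rewrite !gt_eqF // exprn_gt0.
have := error_factor_ge0 s.+1 K y q.
rewrite /error_factor !div1r /=.
have : 0 <= q%:R / (K%:R * y%:R ^+ s.+1) :> R.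
  by rewrite divr_ge0 ?mulr_ge0 ?exprn_ge0.
have : 0 <= q%:R^-1 :> R by rewrite invr_ge0.
have : 0 <= (K%:R ^+ (2 ^ s))^-1 :> R by rewrite invr_ge0 exprn_ge0.
by lra.
Qed.

End ErrorFactor.

Section HarmonicSum.
Context {R : realType}.

Lemma harmonic_sum_le (X : nat) : (0 < X)%N ->
  \sum_(1 <= m < X.+1) m%:R^-1 <= 1 + ln X%:R :> R.
Proof.
case: X => // X _; elim: X => [|X IHX].
  by rewrite big_nat1 invr1 ln1 addr0.
rewrite big_nat_recr //=; apply: le_trans (lerD IHX (lexx _)) _.
rewrite -addrA lerD2l -lerBrDl.
have X1 : 0 < X.+1%:R :> R by rewrite ltr0n.
have X2 : 0 < X.+2%:R :> R by rewrite ltr0n.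
have := @le_ln1Dx R (- X.+2%:R^-1).
rewrite ltrN2 invf_lt1 // ltr1n => /(_ isT).
rewrite (_ : 1 - X.+2%:R^-1 = X.+1%:R / X.+2%:R); last first.
  by have := ler0n R X; rewrite -!natr1 => ?; field; lra.
by rewrite ln_div ?posrE // lerNr opprB.
Qed.

Lemma harmonic_sum_le_ln (X x d : nat) :
  (0 < X <= x ^ d)%N -> 1 <= ln x%:R :> R ->
  \sum_(1 <= m < X.+1) m%:R^-1 <= d.+1%:R * ln x%:R :> R.
Proof.
move=> /andP[X0 Xx] lnx1; apply: le_trans (harmonic_sum_le X0) _.
have x0 : (0 < x)%N.
  by rewrite lt0n; apply: contraL lnx1 => /eqP ->; rewrite ln0 ?ler10.
rewrite -natr1 mulrDl mul1r [leRHS]addrC lerD // mulr_natl -lnXn ?ltr0n //.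
by rewrite ler_ln ?posrE ?exprn_gt0 ?ltr0n // -natrX ler_nat.
Qed.

Lemma mean_tau_sqr_le_ln (k X x d : nat) :
  (0 < X <= x ^ d)%N -> 1 <= ln x%:R :> R ->
  mean X (fun m => (tau k m)%:R ^+ 2) <=
  (d.+1%:R * ln x%:R) ^+ (k.+1 ^ 2) :> R.
Proof.
move=> Xx lnx1; apply: le_trans (mean_tau_sqr_le _ _) _.
rewrite lerXn2r ?nnegrE ?harmonic_sum_le_ln //.
  by apply: sumr_ge0 => m _; rewrite invr_ge0.
by rewrite mulr_ge0 // (le_trans ler01).
Qed.

End HarmonicSum.

Section MeanValue.
Context {R : realType}.
Variables (s K x y q : nat) (alpha theta : R) (a : int).
Hypotheses (K0 : (0 < K)%N) (Ky : (K <= y)%N) (yx : (y < x)%N) (q0 : (0 < q)%N).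
Hypothesis lnx1 : 1 <= ln x%:R :> R.
Hypotheses (aq : coprimez a q%:Z) (theta1 : `|theta| <= 1).
Hypothesis alphaE : alpha = a%:~R / q%:R + theta / q%:R ^+ 2.

Local Notation E := (error_factor s.+1 K y q).
Local Notation Lambda := (ln x%:R ^+ (s.+1 ^ 2)).

Let y0 : (0 < y)%N. Proof. exact: leq_trans Ky. Qed.

Definition mean_value_const : R :=
  48 * s.+1`!%:R * s.+2%:R ^+ (s.+1 ^ 2).

Lemma sqr_mean_weyl_mean_le :
  mean K (fun j => weyl_mean y s (j%:R * alpha)) ^+ 2 <=
  mean_value_const * (E * Lambda).
Proof.
set X := (K * y ^ s)%N; set c := s.+1`!.
have c0 : (0 < c)%N by exact: fact_gt0.
have X0 : (0 < X)%N by rewrite muln_gt0 K0 expn_gt0 y0.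
have X_le : (0 < X <= x ^ s.+1)%N.
  rewrite X0 expnS leq_mul ?(leq_trans Ky) ?(ltnW yx) //.
  by case: (s) => // s'; rewrite leq_exp2r // ltnW.
have yR0 : 0 < y%:R :> R by rewrite ltr0n.
pose g m : R := geom_bound y%:R ((c * m)%:R * alpha).
have g0 m : 0 <= g m by exact: geom_bound_ge0.
have weyl0 : 0 <= mean K (fun j => weyl_mean y s (j%:R * alpha)).
  by apply: mean_ge0 => j; exact: weyl_mean_ge0.
apply: (@le_trans _ _ (mean X (fun m => (tau s m)%:R * g m) ^+ 2)).
  have weyl_le := mean_weyl_mean_le y s K alpha.
  by apply: lerXn2r; rewrite ?nnegrE // (le_trans weyl0).
apply: le_trans (mean_CauchySchwarz _ _ _) _.
have g_le : mean X (fun m => g m ^+ 2) <= 24 * c%:R * (2 * E).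
  apply: le_trans (mean_geom_bound_sqr_le q0 yR0 aq theta1 alphaE c0 X0) _.
  rewrite ler_wpM2l ?mulr_ge0 // natrM natrX.
  exact: cross_terms_le_error_factor.
have -> : mean_value_const * (E * Lambda) =
    (s.+2%:R * ln x%:R) ^+ (s.+1 ^ 2) * (24 * c%:R * (2 * E)).
  by rewrite /mean_value_const -/c exprMn; ring.
apply: ler_pM g_le; last exact: mean_tau_sqr_le_ln.
- by apply: mean_ge0 => m; exact: sqr_ge0.
- by apply: mean_ge0 => m; exact: sqr_ge0.
Qed.

Variables (f : {poly R}) (A : nat).
Hypotheses (sf : (size f <= s.+2)%N) (f_alpha : f`_s.+1 = alpha).

Definition complete_sums_const : R :=
  weyl_const s ^+ 2 * (2 * (1 + mean_value_const)).

Lemma mean_complete_sums_le :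
  mean_exp_sum (fun u => f.[u%:R]) predT A y K ^+ (2 ^ s * 2) <=
  complete_sums_const * (E * Lambda).
Proof.
pose t h := normc (weyl_sum (h%:R *: f) A y) / y%:R.
rewrite /mean_exp_sum (eq_mean (G := t)); last first.
  move=> h _; congr (normc _ / _).
  by apply: eq_bigr => u _; rewrite hornerZ.
have t0 h : 0 <= t h by rewrite divr_ge0 ?normc_ge0.
set W := mean K (fun j => weyl_mean y s (j%:R * alpha)).
have W0 : 0 <= W by apply: mean_ge0 => j; exact: weyl_mean_ge0.
have yV0 : 0 <= y%:R^-1 :> R by rewrite invr_ge0.
have tN_le : mean K t ^+ (2 ^ s) <= weyl_const s * (y%:R^-1 + W).
  apply: le_trans (exprn_mean_le _ K0 t0) _; rewrite -meanDl // -meanZ.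
  apply: ler_mean => h _; rewrite -f_alpha -coefZ.
  by apply: weyl_inequality => //; exact: leq_trans (size_scale_leq _ _) sf.
have yV_le : y%:R^-1 ^+ 2 <= E * Lambda :> R.
  apply: (@le_trans _ _ y%:R^-1).
    by rewrite ler_iXnr // invf_le1 ?ler1n ?ltr0n.
  apply: le_trans (invy_le_error_factor s.+1 K y q) _.
  by rewrite ler_peMr ?error_factor_ge0 // exprn_ege1.
rewrite exprM; apply: (@le_trans _ _ ((weyl_const s * (y%:R^-1 + W)) ^+ 2)).
  have mean0 : 0 <= mean K t ^+ (2 ^ s) by rewrite exprn_ge0 ?mean_ge0.
  by apply: lerXn2r; rewrite ?nnegrE // (le_trans mean0).
rewrite exprMn -[leRHS]mulrA ler_wpM2l ?sqr_ge0 //.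
have := sqr_mean_weyl_mean_le; rewrite -/W.
by have := sqr_ge0 (y%:R^-1 - W); lra.
Qed.

Definition sifted_sums_const : R :=
  4 ^+ (2 ^ s * 2) * (1 + complete_sums_const).

Lemma mean_sifted_sums_le (P : pred nat) :
  mean_exp_sum (fun u => f.[u%:R]) P A y K ^+ (2 ^ s.+2) <=
  sifted_sums_const * (E * Lambda).
Proof.
have -> : (2 ^ s.+2 = 2 * (2 ^ s * 2))%N by rewrite !expnS [(2 ^ s * 2)%N]mulnC.
have sqr_le := sqr_mean_exp_sum_le (fun u => f.[u%:R]) P A K0 y0.
have KV0 : 0 <= K%:R^-1 :> R by rewrite invr_ge0.
apply: le_trans (exprn_double_le _ KV0 (mean_exp_sum_ge0 _ _ _ _ _) sqr_le) _.
rewrite -[leRHS]mulrA ler_wpM2l ?exprn_ge0 // mulrDl mul1r.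
rewrite lerD ?mean_complete_sums_le //; apply: (@le_trans _ _ E); last first.
  by rewrite ler_peMr ?error_factor_ge0 // exprn_ege1.
apply: le_trans (invK_le_error_factor s.+1 K y q).
rewrite exprVn lef_pV2 ?posrE ?exprn_gt0 ?ltr0n //.
by rewrite ler_weXn2l ?ler1n // leq_pmulr.
Qed.

End MeanValue.

Section Conclusion.
Context {R : realType}.

Lemma sifted_sums_const_gt0 s : 0 < sifted_sums_const s :> R.
Proof.
rewrite mulr_gt0 ?exprn_gt0 // ltr_wpDr // mulr_ge0 ?sqr_ge0 //.
by rewrite mulr_ge0 ?addr_ge0 ?mulr_ge0 ?exprn_ge0.
Qed.

Lemma le_powR_root (v c E L : R) (m d : nat) :
  (0 < m)%N -> 0 <= v -> 0 <= c -> 0 <= E -> 0 <= L ->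
  v ^+ m <= c * (E * L ^+ d) ->
  v <= c `^ m%:R^-1 * (E `^ m%:R^-1 * L `^ (d%:R / m%:R)).
Proof.
move=> m0 v0 c0 E0 L0 vm; have mR0 : m%:R != 0 :> R by rewrite pnatr_eq0 -lt0n.
have -> : v = (v ^+ m) `^ m%:R^-1.
  by rewrite -powR_mulrn // -powRrM mulfV // powRr1.
rewrite powRrM powR_mulrn // -!powRM ?mulr_ge0 ?exprn_ge0 //.
by rewrite ge0_ler_powR ?nnegrE ?invr_ge0 ?mulr_ge0 ?exprn_ge0.
Qed.

Lemma V_mean (f : {poly R}) (K x y : nat) : (0 < K)%N -> (0 < y < x)%N ->
  V f K x y =
  K%:R * y%:R * mean_exp_sum (fun u => f.[u%:R]) prime (x - y).+1 y K.
Proof.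
move=> K0 /andP[y0 yx]; rewrite /mean_exp_sum addSn subnK ?(ltnW yx) //.
rewrite /mean -mulr_suml /V.
by field; rewrite !pnatr_eq0 -!lt0n K0.
Qed.

Lemma ln_nat_ge1 (x : nat) :
  (Num.truncn (expR 1 : R) < x)%N -> 1 <= ln x%:R :> R.
Proof.
move=> ex; have x0 : (0 < x)%N by exact: leq_ltn_trans ex.
rewrite -[leLHS](expRK 1) ler_ln ?posrE ?expR_gt0 ?ltr0n //.
by apply/ltW/(lt_le_trans (truncnS_gt _)); rewrite ler_nat.
Qed.

End Conclusion.

Theorem theorem1 (R : realType) (n : nat) (hn : (0 < n)%N) :
  exists (C : R) (N0 : nat), 0 < C /\
  forall (K x y q : nat) (f : {poly R}) (alpha theta : R) (a : int),
    (N0 <= K)%N -> (N0 <= x)%N -> (N0 <= y)%N -> (N0 <= q)%N ->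
    (K <= y)%N -> (y < x)%N ->
    size f = n.+1 -> f`_n = alpha -> f`_0 = 0 ->
    alpha = a%:~R / q%:R + theta / q%:R ^+ 2 ->
    coprimez a q%:Z -> (1 <= q)%N -> `|theta| <= 1 ->
    V f K x y <=
      C * (K%:R * y%:R *
        (1 / q%:R + 1 / y%:R + q%:R / (K%:R * y%:R ^+ n)
           + 1 / K%:R ^+ (2 ^ n.-1)%N) `^ (2 ^- n.+1)
        * (ln x%:R) `^ ((n ^ 2)%N%:R / 2 ^+ n.+1)).
Proof.
case: n hn => // s _.
exists (sifted_sums_const s `^ (2 ^+ s.+2)^-1), (Num.truncn (expR 1 : R)).+1.
split; first by rewrite powR_gt0 ?sifted_sums_const_gt0.
move=> K x y q f alpha theta a NK Nx _ _ Ky yx sf f_alpha _ alphaE aq q0 theta1.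
have K0 : (0 < K)%N by exact: leq_trans NK.
have y0 : (0 < y)%N by exact: leq_trans Ky.
have lnx1 : 1 <= ln x%:R :> R by exact: ln_nat_ge1.
have := mean_sifted_sums_le K0 Ky yx q0 lnx1 aq theta1 alphaE (x - y).+1
  (eq_leq sf) f_alpha prime.
rewrite -/(error_factor s.+1 K y q) V_mean ?y0 //.
move=> /(le_powR_root _ (mean_exp_sum_ge0 _ _ _ _ _)
  (ltW (sifted_sums_const_gt0 s)) (error_factor_ge0 _ _ _ _)
  (le_trans ler01 lnx1)).
rewrite expn_gt0 natrX => /(_ isT) mean_le.
by rewrite -[X in _ <= _ * X]mulrA [leRHS]mulrCA ler_wpM2l ?mulr_ge0.
Qed.
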